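(* Let $\Gamma$ be a finitely generated group with a fixed finite symmetric generating set, and let $\mu\in\mathrm{Prob}(\Gamma)$ be a symmetric probability measure supported on the ball of radius $N$. Let $g\in\Gamma$, and denote by $\kappa_n$ the probability of return to the origin after $n$ steps in the $\mu$-random walk on the Schreier graph $\Gamma/C_\Gamma(g)$. If $$\liminf_{n\to\infty}\ \rho\big(2nN+|g|\big)\,\kappa_{2n}^{1/4}=0,$$ then every $\mu$-stationary state $\tau$ on $\mathrm{C}^*_r(\Gamma)$ vanishes at $g$, i.e. $\tau(\lambda_g)=0$.
   Context: $|g|$ denotes the word length of $g$, and $B_n(\Gamma)$ is the ball of radius $n$ around the identity. $\lambda$ is the left regular representation of $\Gamma$ on $\ell^2(\Gamma)$ (extended linearly to $\mathbb{C}\Gamma$), and $\mathrm{C}^*_r(\Gamma)$ is the reduced C*-algebra, the norm closure of $\lambda(\mathbb{C}\Gamma)$. Define $$\rho(n)=\max\left\{\frac{\|\lambda(f)\|}{\|f\|_2}: 0\neq f\in\mathbb{C}\Gamma,\ \mathrm{supp}(f)\subseteq B_n(\Gamma)\right\}.$$ $C_\Gamma(g)$ is the centralizer of $g$. The measure $\mu$ is symmetric if $\mu(t)=\mu(t^{-1})$ for all $t\in\Gamma$. The $\mu$-random walk on $\Gamma/C_\Gamma(g)$ moves from a coset $hC_\Gamma(g)$ to $thC_\Gamma(g)$, with $t$ chosen according to $\mu$; its origin is the trivial coset, so $\kappa_n=\mu^{*n}(C_\Gamma(g))$, where $\mu^{*n}$ is the $n$-fold convolution power. A state $\tau$ on $\mathrm{C}^*_r(\Gamma)$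 is $\mu$-stationary if $\tau(a)=\sum_{t\in\Gamma}\mu(t)\,\tau(\lambda_t a\lambda_{t^{-1}})$ for all $a\in\mathrm{C}^*_r(\Gamma)$. *)

(* Defs.v *)
From HB Require Import structures.
From mathcomp Require Import all_boot all_order all_algebra finmap complex.
From mathcomp Require Import all_classical all_reals all_analysis.
From mathcomp Require Import ring.

Set Implicit Arguments.
Unset Strict Implicit.
Unset Printing Implicit Defensive.
Import Order.TTheory GRing.Theory Num.Theory.
Import ComplexField.
Local Open Scope classical_set_scope.
Local Open Scope ring_scope.
Local Open Scope complex_scope.

(* Groups are [groupType]s, written multiplicatively and possibly infinite;
   the complex numbers are [R[i]] with [R : realType]. *)

Section word_metric.
Variables (G : groupType) (S : {fset G}).

Definition is_word (w : seq G) (x : G) : Prop :=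
  {subset w <= S} /\ (\prod_(s <- w) s)%g = x.

Definition symmetric_set : Prop := forall s, s \in S -> (s^-1)%g \in S.

(* For a symmetric S the submonoid generated by S is the subgroup it
   generates. *)
Definition generates : Prop := forall x, exists w, is_word w x.

(* The default value 0 is only reached when no word represents x. *)
Definition word_length (x : G) : nat :=
  xget 0%N [set n | (exists2 w, is_word w x & size w = n) /\
                    (forall w, is_word w x -> (n <= size w)%N)].

Definition word_ball (n : nat) : set G := [set x | (word_length x <= n)%N].

End word_metric.

Section random_walk.
Variables (R : realType) (G : groupType) (mu : G -> R).

Definition is_prob : Prop :=
  (forall t, 0 <= mu t) /\ (\esum_(t in [set: G]) (mu t)%:E)%E = 1%:E.

Definition symmetric_measure : Prop := forall t, mu t = mu (t^-1)%g.

Definition centralizer (g : G) : set G := [set h | commute h g].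

(* The left coset t^-1 D of a left coset D. *)
Definition translate_inv (t : G) (D : set G) : set G :=
  [set x | D (t * x)%g].

(* Probability that the walk on the left cosets G/H moving from D to tD with
   probability mu t, started at the coset H, is at the coset D after n steps:
   it reaches D at step n+1 through t exactly when it is at t^-1 D at step n. *)
Fixpoint walk_prob (H : set G) (n : nat) (D : set G) : \bar R :=
  if n is m.+1
  then (\esum_(t in [set: G])
          ((mu t)%:E * walk_prob H m (translate_inv t D)))%E
  else if `[< D = H >] then 1%:E else 0%:E.

Definition return_prob (g : G) (n : nat) : R :=
  fine (walk_prob (centralizer g) n (centralizer g)).

End random_walk.

Section square_summable.
Variables (R : realType) (G : groupType).
Implicit Type f : G -> R[i].

Definition sqnorm f : \bar R :=
  (\esum_(x in [set: G]) ((Normc.normc (f x)) ^+ 2)%:E)%E.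

Definition l2norm f : R := Num.sqrt (fine (sqnorm f)).

Definition sqsummable : {pred G -> R[i]} :=
  [pred f : G -> R[i] | `[< (sqnorm f < +oo)%E >]].

Lemma sqnorm_translate f (t : G) :
  sqnorm (fun x => f (t * x)%g) = sqnorm f.
Proof.
rewrite /sqnorm [RHS](@reindex_esum _ _ _ setT setT (fun x => (t * x)%g)) //.
split=> // [x y _ _ /= | y _]; first exact: (@mulgI _ t).
by exists (t^-1 * y)%g => //=; rewrite mulVKg.
Qed.

Lemma normc_sqr_scaleD (k z w : R[i]) :
  (Normc.normc (k * z + w)) ^+ 2 <=
  (2 * Normc.normc k ^+ 2) * Normc.normc z ^+ 2 + 2 * Normc.normc w ^+ 2.
Proof.
case: k z w => [k1 k2] [z1 z2] [w1 w2].
rewrite /Normc.normc /= !sqr_sqrtr ?addr_ge0 ?sqr_ge0 //.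
set a := k1 * z1 - k2 * z2; set b := k1 * z2 + k2 * z1.
have -> : (2 * (k1 ^+ 2 + k2 ^+ 2)) * (z1 ^+ 2 + z2 ^+ 2) =
          2 * (a ^+ 2 + b ^+ 2) by rewrite /a /b; ring.
have h1 := sqr_ge0 (a - w1); have h2 := sqr_ge0 (b - w2).
rewrite -subr_ge0.
have -> : 2 * (a ^+ 2 + b ^+ 2) + 2 * (w1 ^+ 2 + w2 ^+ 2) -
  ((a + w1) ^+ 2 + (b + w2) ^+ 2) = (a - w1) ^+ 2 + (b - w2) ^+ 2 by ring.
exact: addr_ge0.
Qed.

Lemma esum_scale_lty (c : R) (u : G -> R) :
  0 <= c -> (forall x, 0 <= u x) ->
  (\esum_(x in [set: G]) (u x)%:E < +oo)%E ->
  (\esum_(x in [set: G]) (c * u x)%:E < +oo)%E.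
Proof.
move=> c0 u0 uoo; apply: (@le_lt_trans _ _ (c%:E * \esum_(x in setT) (u x)%:E)%E).
  apply: ge_ereal_sup => _ [A finA <-].
  under eq_fsbigr do rewrite EFinM.
  rewrite -ge0_mule_fsumr; last by move=> x; rewrite lee_fin.
  by rewrite lee_wpmul2l ?lee_fin//; apply: ereal_sup_ubound; exists A.
by rewrite lte_mul_pinfty.
Qed.

Lemma sqsummable_submod : submod_closed sqsummable.
Proof.
split=> [|k f h]; rewrite !inE.
  rewrite /sqnorm esum1 // => x _.
  by rewrite (_ : Normc.normc _ = 0) ?expr0n //; exact: Normc.normc0.
rewrite /sqnorm => foo hoo.
set u := fun x => (2 * Normc.normc k ^+ 2) * Normc.normc (f x) ^+ 2.
set v := fun x => 2 * Normc.normc (h x) ^+ 2.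
apply: (@le_lt_trans _ _ (\esum_(x in setT) ((u x)%:E + (v x)%:E))%E).
  by apply: le_esum => x _; rewrite -EFinD lee_fin normc_sqr_scaleD.
have c0 : 0 <= 2 * Normc.normc k ^+ 2 by rewrite pmulr_rge0 ?sqr_ge0.
have u0 x : 0 <= u x by apply: mulr_ge0 => //; exact: sqr_ge0.
have v0 x : 0 <= v x by rewrite /v pmulr_rge0 ?sqr_ge0.
rewrite esumD => [|x _|x _]; rewrite ?lee_fin //.
by rewrite lte_add_pinfty // esum_scale_lty // => x; exact: sqr_ge0.
Qed.

HB.instance Definition _ :=
  GRing.isSubmodClosed.Build R[i] (G -> R[i]) sqsummable sqsummable_submod.

End square_summable.

Record ell2 (R : realType) (G : groupType) := Ell2 {
  ell2_fun :> G -> R[i];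
  ell2P : ell2_fun \in @sqsummable R G }.

HB.instance Definition _ R G := [isSub of ell2 R G for @ell2_fun R G].
HB.instance Definition _ R G := [Choice of ell2 R G by <:].
HB.instance Definition _ R G := [SubChoice_isSubLmodule of ell2 R G by <:].

Section complex_sum.
Variables (R : realType) (I : choiceType).

(* Sum of an absolutely summable complex family, through the positive and
   negative parts of the real and imaginary parts. *)
Definition real_sum (u : I -> R) : R :=
  fine (\esum_(i in [set: I]) (Num.max (u i) 0)%:E)%E -
  fine (\esum_(i in [set: I]) (Num.max (- u i) 0)%:E)%E.

Definition complex_sum (u : I -> R[i]) : R[i] :=
  real_sum (fun i => complex.Re (u i)) +i* real_sum (fun i => complex.Im (u i)).

End complex_sum.

Section operators.
Variables (R : realType) (G : groupType).
Local Notation H := (ell2 R G).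
Implicit Types (xi eta : H) (a b : H -> H).

Definition inner xi eta : R[i] := complex_sum (fun x => xi x * (eta x)^*).

Definition bounded_operator a : Prop :=
  linear a /\ exists M : R, forall xi, l2norm (a xi) <= M * l2norm xi.

Definition opnorm a : R :=
  sup [set l2norm (a xi) | xi in [set xi : H | l2norm xi <= 1]].

Definition is_adjoint a b : Prop :=
  forall xi eta, inner (a xi) eta = inner xi (b eta).

Lemma translate_sqsummable (t : G) xi :
  (fun x => xi (t^-1 * x)%g) \in @sqsummable R G.
Proof. by rewrite inE sqnorm_translate; have := ell2P xi; rewrite inE. Qed.

Definition lambda (t : G) : H -> H :=
  fun xi => Ell2 (translate_sqsummable t xi).

(* The group algebra is represented by the finitely supported functions. *)
Definition lambda_alg (f : {fsfun G -> R[i] with 0}) : H -> H :=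
  \sum_(t <- finsupp f) f t *: lambda t.

(* The norm closure of the image of the group algebra in B(ell2). *)
Definition reduced_cstar : set (H -> H) :=
  [set a | bounded_operator a /\
     forall e : R, 0 < e ->
       exists f : {fsfun G -> R[i] with 0}, opnorm (a - lambda_alg f) < e].

(* A functional on the reduced C*-algebra is a function of which only the
   values on [reduced_cstar] matter. *)
Definition functional_norm (tau : (H -> H) -> R[i]) : R :=
  sup [set Normc.normc (tau a) |
        a in [set a | reduced_cstar a /\ opnorm a <= 1]].

(* Positive linear functionals of norm one; positivity is tau(a* a) >= 0. *)
Definition is_state (tau : (H -> H) -> R[i]) : Prop :=
  [/\ forall (k : R[i]) a b, reduced_cstar a -> reduced_cstar b ->
        tau (k *: a + b) = k * tau a + tau b,
      forall a b, reduced_cstar a -> is_adjoint a b -> 0 <= tau (b \o a) &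
      functional_norm tau = 1].

Definition stationary (mu : G -> R) (tau : (H -> H) -> R[i]) : Prop :=
  forall a, reduced_cstar a ->
    tau a = complex_sum (fun t =>
      (mu t)%:C * tau (lambda t \o a \o lambda (t^-1)%g)).

(* The set is bounded, as ||lambda f|| is at most the l1 norm of f and the
   ball is finite, and the supremum is attained. *)
Definition rho (S : {fset G}) (n : nat) : R :=
  sup [set opnorm (lambda_alg f) / l2norm f |
        f in [set f : {fsfun G -> R[i] with 0} |
               f <> [fsfun] /\ [set` finsupp f] `<=` word_ball S n]].

End operators.

Arguments rho R {G} S n.

(* Main.v *)
Require Import Defs.
From mathcomp Require Import all_boot all_order all_algebra finmap complex.
From mathcomp Require Import all_classical all_reals all_analysis.
From mathcomp Require Import ring.
Import Order.TTheory GRing.Theory Num.Theory.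
Local Open Scope classical_set_scope.
Local Open Scope ring_scope.
Local Open Scope complex_scope.

(** The coset h C(g) is determined by the conjugate h g h^-1, so the walk on
    G/C(g) is the walk x -> t x t^-1 on the conjugacy class of g, with t
    distributed according to mu. Let p_n(x, y) be its n-step transition
    probabilities ([conj_kernel]), so that kappa_n = p_n(g, g)
    ([return_prob_conj_kernel]).

    Stationarity of tau says that y |-> tau(lambda_y) is harmonic for this walk.
    After n steps this reads tau(lambda_g) = tau(lambda(F)) with
    F = p_n(g, .), a function supported in the ball of radius 2nN + |g|, because
    conjugating by an element of the support of mu increases the length by at
    most 2N. A state is bounded by the operator norm, hence
      |tau(lambda_g)| <= ||lambda(F)|| <= rho(2nN + |g|) ||F||_2.
    Since mu is symmetric, p_n is symmetric, and the Chapman-Kolmogorov relation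
    gives ||F||_2^2 = sum_y p_n(g, y) p_n(y, g) = p_2n(g, g) = kappa_2n
    ([conj_kernel_sqr_sum]). So |tau(lambda_g)| <= rho(2nN + |g|) kappa_2n^(1/2)
    for every n ([stationary_state_bound]), and kappa_2n^(1/2) <= kappa_2n^(1/4)
    because kappa_2n <= 1: the constant |tau(lambda_g)| lies below a sequence
    whose lower limit is 0.

    The measure mu has finite support, since balls are finite, so all averages
    over mu are finite sums. *)

Set Implicit Arguments.
Unset Strict Implicit.
Unset Printing Implicit Defensive.
Import ComplexField.

(** * The conjugation random walk *)

Section conjugation_kernel.
Variables (K : comNzRingType) (G : groupType) (T : {fset G}) (w : G -> K).
Implicit Types (h : G -> K) (x y : G).

Definition conj_avg h x : K := \sum_(t <- T) w t * h (t * x * t^-1)%g.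

(** The n-step transition probability from x to y, as the n-th power of the
    Markov operator evaluated on the indicator of y. *)
Definition conj_kernel n x y : K := iter n conj_avg (fun z => (z == y)%:R) x.

Lemma conj_kernelS n x y :
  conj_kernel n.+1 x y = \sum_(t <- T) w t * conj_kernel n (t * x * t^-1)%g y.
Proof. by []. Qed.

Lemma conj_avg_iter_sum (I : Type) (r : seq I) (c : I -> K) (h : I -> G -> K)
    n x :
  iter n conj_avg (fun z => \sum_(i <- r) c i * h i z) x =
  \sum_(i <- r) c i * iter n conj_avg (h i) x.
Proof.
elim: n x => [//|n IH] x; rewrite iterS /conj_avg.
under eq_bigr do rewrite IH mulr_sumr.
rewrite exchange_big /=; apply: eq_bigr => i _.
by rewrite mulr_sumr; apply: eq_bigr => t _; rewrite mulrCA.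
Qed.

(** Here and below [B y m] says that a walk at y with m steps left stays in a
    controlled region: it is inherited along each step, and at time 0 it bounds
    where the walk has arrived. In the application it is a bound on the word
    length of y by a quantity that decreases with m. *)
Lemma eq_conj_avg_iter (B : G -> pred nat) n h h' x :
  (forall t y m, t \in T -> B y m.+1 -> B (t * y * t^-1)%g m) ->
  (forall y, B y 0%N -> h y = h' y) -> B x n ->
  iter n conj_avg h x = iter n conj_avg h' x.
Proof.
move=> BT hh'; elim: n x => [|n IH] x Bx; first exact: hh'.
rewrite !iterS /conj_avg big_seq [RHS]big_seq; apply: eq_bigr => t tT.
by rewrite IH//; exact: BT.
Qed.

(** Within the reach of n steps, h is the finite combination of indicators
    [\sum_(y <- X) h y * (_ == y)%:R], and the Markov operator is linear. *)
Lemma conj_kernel_expansion (B : G -> pred nat) (X : {fset G}) n h x :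
  (forall t y m, t \in T -> B y m.+1 -> B (t * y * t^-1)%g m) ->
  (forall y, B y 0%N -> y \in X) -> B x n ->
  iter n conj_avg h x = \sum_(y <- X) h y * conj_kernel n x y.
Proof.
move=> BT BX Bx; rewrite -conj_avg_iter_sum.
apply: eq_conj_avg_iter BT _ Bx => y /BX yX.
rewrite (bigD1_seq y) ?fset_uniq//= eqxx mulr1 big1 ?addr0// => z zy.
by rewrite eq_sym (negPf zy) mulr0.
Qed.

Hypothesis T_inv : forall t, t \in T -> (t^-1)%g \in T.
Hypothesis w_inv : forall t, w (t^-1)%g = w t.

Lemma sum_inv (F : G -> K) : \sum_(t <- T) F (t^-1)%g = \sum_(t <- T) F t.
Proof.
rewrite -[LHS](big_map _ predT); apply: perm_big.
apply: uniq_perm; rewrite ?fset_uniq//.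
  by rewrite map_inj_uniq ?fset_uniq//; exact: invg_inj.
move=> t; apply/mapP/idP => [[s sT ->]|tT]; first exact: T_inv.
by exists (t^-1)%g; rewrite ?invgK//; exact: T_inv.
Qed.

(** The last step of the walk can be split off instead of the first: one
    application of the operator to the indicator of y averages the indicators of
    the t^-1 y t, and the symmetry of the weights turns t^-1 into t. *)
Lemma conj_kernelSr n x y :
  conj_kernel n.+1 x y = \sum_(t <- T) w t * conj_kernel n x (t * y * t^-1)%g.
Proof.
rewrite /conj_kernel iterSr -conj_avg_iter_sum; congr (iter n _ _ x).
apply/funext => z; rewrite -[RHS]sum_inv; apply: eq_bigr => t _.
rewrite w_inv invgK; congr (_ * (_ : bool)%:R).
by apply/eqP/eqP => [<-|->];
  rewrite !mulgA ?(mulVg, mulgV) ?mul1g ?mulgVK ?mulgK.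
Qed.

Lemma conj_kernel_sym n x y : conj_kernel n x y = conj_kernel n y x.
Proof.
elim: n x y => [|n IH] x y; first by rewrite /conj_kernel /= eq_sym.
by rewrite conj_kernelSr conj_kernelS; under eq_bigr do rewrite IH.
Qed.

(** Chapman-Kolmogorov at time n + n, with one factor reversed by symmetry. *)
Lemma conj_kernel_sqr_sum (B : G -> pred nat) (X : {fset G}) n x :
  (forall t y m, t \in T -> B y m.+1 -> B (t * y * t^-1)%g m) ->
  (forall y, B y 0%N -> y \in X) -> B x n ->
  \sum_(y <- X) conj_kernel n x y ^+ 2 = conj_kernel (2 * n) x x.
Proof.
move=> BT BX Bx; rewrite mul2n -addnn /conj_kernel iterD.
rewrite (conj_kernel_expansion _ BT BX Bx); apply: eq_bigr => y _.
by rewrite expr2 [X in X * _]conj_kernel_sym.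
Qed.

End conjugation_kernel.

(** Probabilities are real, whereas the functions averaged by the walk are
    complex; the two kernels correspond through the embedding of the reals. *)
Lemma conj_kernel_rmorph (K L : comNzRingType) (f : {rmorphism K -> L})
    (G : groupType) (T : {fset G}) (w : G -> K) n x y :
  conj_kernel T (fun t => f (w t)) n x y = f (conj_kernel T w n x y).
Proof.
elim: n x => [|n IH] x; first by rewrite /conj_kernel /= rmorph_nat.
rewrite !conj_kernelS rmorph_sum; apply: eq_bigr => t _.
by rewrite rmorphM IH.
Qed.

(** * Word metric *)

Section word_length.
Variables (G : groupType) (S : {fset G}).
Hypothesis S_generates : generates S.

Lemma word_lengthP x :
  (exists2 w, is_word S w x & size w = word_length S x) /\
  (forall w, is_word S w x -> (word_length S x <= size w)%N).
Proof.
rewrite /word_length; case: xgetP => [n -> //|none]; exfalso.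
have [w0 w0x] := S_generates x.
have sz : exists n, `[< exists2 w, is_word S w x & size w = n >].
  by exists (size w0); apply/asboolP; exists w0.
case: (ex_minnP sz) => n /asboolP nP nmin; apply: (none n); split=> // w wx.
by apply: nmin; apply/asboolP; exists w.
Qed.

Lemma word_lengthM x y :
  (word_length S (x * y)%g <= word_length S x + word_length S y)%N.
Proof.
have [[u [uS ux] <-] _] := word_lengthP x.
have [[v [vS vy] <-] _] := word_lengthP y.
rewrite -size_cat; apply: (word_lengthP _).2; split; last first.
  by rewrite big_cat/= ux vy.
by move=> s; rewrite mem_cat => /orP[/uS|/vS].
Qed.

Lemma finite_word_ball n : finite_set (word_ball S n).
Proof.
pose X k := [set x | exists2 w, is_word S w x & size w = k].
have finX k : finite_set (X k).
  elim: k => [|k IH].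
    apply: (sub_finite_set _ (finite_set1 1%g)) => x [w [_ <-] /size0nil ->].
    by rewrite /= big_nil.
  have finS : finite_set [set` S] by exact: finite_fset.
  apply: sub_finite_set (finite_image2 (fun s y => (s * y)%g) finS IH).
  move=> x [[//|s w] [sS <-] [szw]]; exists s; first exact/sS/mem_head.
  exists (\prod_(t <- w) t)%g; last by rewrite big_cons.
  by exists w => //; split=> // t tw; apply: sS; rewrite inE tw orbT.
apply: (sub_finite_set _ (bigcup_finite (finite_II n.+1) (fun k _ => finX k))).
move=> x xn; exists (word_length S x); first by rewrite /= ltnS.
exact: (word_lengthP x).1.
Qed.

End word_length.

(** * Sums with finite support and lower limits *)

Section finite_sums.
Variables (R : realType) (I : choiceType) (X : {fset I}).

Lemma esum_finite_support (u : I -> R) :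
  (forall i, 0 <= u i) -> (forall i, u i != 0 -> i \in X) ->
  (\esum_(i in [set: I]) (u i)%:E)%E = (\sum_(i <- X) u i)%:E.
Proof.
move=> u0 uX; transitivity (\esum_(i in [set` X]) (u i)%:E)%E.
  rewrite [RHS]esum_mkcond; apply: eq_esum => i _; case: ifPn => //.
  rewrite notin_setE /= => /negP iX; congr _%:E; apply/eqP; apply: contraNT iX.
  exact: uX.
rewrite esum_fset//; last by move=> i _; rewrite lee_fin.
by rewrite fsbig_finite//= set_fsetK sumEFin.
Qed.

Lemma real_sum_finite_support (u : I -> R) :
  (forall i, u i != 0 -> i \in X) -> real_sum u = \sum_(i <- X) u i.
Proof.
have fin (v : I -> R) : (forall i, v i != 0 -> i \in X) ->
    fine (\esum_(i in [set: I]) (Num.max (v i) 0)%:E)%E =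
    \sum_(i <- X) Num.max (v i) 0.
  move=> vX; rewrite esum_finite_support// => i.
    by rewrite le_max lexx orbT.
  by move=> vi; apply: vX; apply: contraNneq vi => ->; rewrite maxxx.
move=> uX; rewrite /real_sum !fin//; last first.
  by move=> i; rewrite oppr_eq0; exact: uX.
rewrite -sumrB; apply: eq_bigr => i _.
(* max (- u) 0 = - min u 0, and max + min is the sum of the arguments. *)
by rewrite -{2}[0]oppr0 -oppr_min opprK addr_max_min addr0.
Qed.

Lemma complex_sum_finite_support (u : I -> R[i]) :
  (forall i, u i != 0 -> i \in X) -> complex_sum u = \sum_(i <- X) u i.
Proof.
move=> uX; rewrite /complex_sum !real_sum_finite_support; first last.
- by move=> i ui; apply: uX; apply: contraNneq ui => ->.
- by move=> i ui; apply: uX; apply: contraNneq ui => ->.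
apply/eqP; rewrite eq_complex /=; apply/andP; split; apply/eqP.
  by rewrite (big_morph _ (id1 := 0) (op1 := +%R) _ _)//; case=> ? ? [].
by rewrite (big_morph _ (id1 := 0) (op1 := +%R) _ _)//; case=> ? ? [].
Qed.

End finite_sums.

Lemma limn_einf_ge (R : realType) (c : \bar R) (u : nat -> \bar R) :
  (forall n, (c <= u n)%E) -> (c <= limn_einf u)%E.
Proof.
move=> cu; rewrite limn_einf_lim; apply: lime_ge; first exact: is_cvg_einfs.
by apply: nearW => n; apply: le_ereal_inf_tmp => _ [m _ <-].
Qed.

Lemma esum_scale (R : realType) (I : choiceType) (c : R) (u : I -> R) :
  0 <= c -> (forall i, 0 <= u i) ->
  (\esum_(i in [set: I]) (c * u i)%:E =
   c%:E * \esum_(i in [set: I]) (u i)%:E)%E.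
Proof.
have le (d : R) (v : I -> R) : 0 <= d -> (forall i, 0 <= v i) ->
    (\esum_(i in [set: I]) (d * v i)%:E <=
     d%:E * \esum_(i in [set: I]) (v i)%:E)%E.
  move=> d0 v0; apply: ge_ereal_sup => _ [A finA <-].
  under eq_fsbigr do rewrite EFinM.
  rewrite -ge0_mule_fsumr; last by move=> i; rewrite lee_fin.
  by rewrite lee_wpmul2l ?lee_fin//; apply: ereal_sup_ubound; exists A.
(* The converse inequality is [le] for the factor c^-1. *)
move=> c0 u0; apply/eqP; rewrite eq_le le//=.
have [->|cN0] := eqVneq c 0.
  by rewrite mul0e; apply: esum_ge0 => i _; rewrite mul0r.
have {c0}cgt0 : 0 < c by rewrite lt_neqAle eq_sym cN0.
rewrite -lee_pdivlMl//; have := le (c^-1) (fun i => c * u i).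
under eq_esum do rewrite mulKf//.
by apply; rewrite ?invr_ge0 ?ltW// => i; rewrite mulr_ge0// ltW.
Qed.

(** * The norm of square-summable functions *)

Lemma normc_ge0 (R : realType) (k : R[i]) : 0 <= Normc.normc k.
Proof. by case: k => a b; exact: sqrtr_ge0. Qed.

Section ell2_norm.
Variables (R : realType) (G : groupType).
Local Notation H := (ell2 R G).
Implicit Types (xi eta : H) (f : G -> R[i]) (k : R[i]).

Lemma sqnorm_ge0 f : (0 <= sqnorm f)%E.
Proof. by apply: esum_ge0 => x _; rewrite lee_fin sqr_ge0. Qed.

Lemma l2norm_ge0 f : 0 <= l2norm f.
Proof. exact: sqrtr_ge0. Qed.

Lemma l2norm_sqr xi : ((l2norm xi ^+ 2)%:E = sqnorm xi)%E.
Proof.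
rewrite sqr_sqrtr ?fine_ge0 ?sqnorm_ge0// fineK//.
rewrite ge0_fin_numE ?sqnorm_ge0//.
by have := ell2P xi; rewrite inE.
Qed.

Lemma l2norm_scale k xi : l2norm (k *: xi) = Normc.normc k * l2norm xi.
Proof.
apply/eqP; rewrite -(@eqrXn2 _ 2) ?mulr_ge0 ?l2norm_ge0 ?normc_ge0//.
apply/eqP; apply: EFin_inj; rewrite l2norm_sqr exprMn EFinM l2norm_sqr.
rewrite -esum_scale ?sqr_ge0// => [|x]; last exact: sqr_ge0.
by apply: eq_esum => x _; rewrite -exprMn -Normc.normcM.
Qed.

Lemma l2norm0 : l2norm (0 : H) = 0.
Proof. by rewrite -(scale0r (0 : H)) l2norm_scale Normc.normc0 mul0r. Qed.

(** A substitute for the triangle inequality, loose by a factor 2 but valid term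
    by term; it is only used to see that operators are bounded, where the value
    of the constant is irrelevant. *)
Lemma l2norm_sqr_scaleD k xi eta :
  l2norm (k *: xi + eta) ^+ 2 <=
  2 * Normc.normc k ^+ 2 * l2norm xi ^+ 2 + 2 * l2norm eta ^+ 2.
Proof.
have c0 : 0 <= 2 * Normc.normc k ^+ 2 by rewrite mulr_ge0 ?sqr_ge0.
rewrite -lee_fin EFinD (EFinM (2 * _)) (EFinM 2 (l2norm eta ^+ 2)) !l2norm_sqr.
rewrite -(esum_scale c0) => [|x]; last exact: sqr_ge0.
rewrite -(esum_scale (ler0n _ 2)) => [|x]; last exact: sqr_ge0.
rewrite -esumD => [|x _|x _]; try by rewrite lee_fin mulr_ge0 ?sqr_ge0.
by apply: le_esum => x _; rewrite -EFinD lee_fin normc_sqr_scaleD.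
Qed.

Lemma l2norm_lambda t xi : l2norm (lambda t xi) = l2norm xi.
Proof. by rewrite /l2norm sqnorm_translate. Qed.

End ell2_norm.

(** * Operators in the reduced C*-algebra *)

Section operator_norm.
Variables (R : realType) (G : groupType).
Local Notation H := (ell2 R G).
Implicit Types (a : H -> H) (xi : H) (f : {fsfun G -> R[i] with 0}).

Lemma opnorm_le a (M : R) : 0 <= M ->
  (forall xi, l2norm (a xi) <= M * l2norm xi) -> opnorm a <= M.
Proof.
move=> M0 aM; apply: ge_sup.
  by exists (l2norm (a 0)); exists 0 => //=; rewrite l2norm0.
move=> _ [xi /= xi1 <-]; apply: le_trans (aM xi) _.
by rewrite -[leRHS]mulr1 ler_wpM2l.
Qed.

Lemma opnorm_ub a xi : bounded_operator a -> l2norm xi <= 1 ->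
  l2norm (a xi) <= opnorm a.
Proof.
move=> [_ [M aM]] xi1; apply: sup_ubound; last by exists xi.
exists (Num.max M 0) => _ [eta /= eta1 <-]; apply: le_trans (aM eta) _.
rewrite -[leRHS]mulr1; apply: le_trans (ler_wpM2r (l2norm_ge0 _) _) _.
  by apply: (@le_trans _ _ (Num.max M 0)); rewrite ?le_max ?lexx//.
by rewrite ler_wpM2l// le_max lexx orbT.
Qed.

Lemma opnorm_ge0 a : bounded_operator a -> 0 <= opnorm a.
Proof.
move=> ba; apply: le_trans (l2norm_ge0 (a 0)) _.
by apply: opnorm_ub => //; rewrite l2norm0.
Qed.

Lemma opnorm_scale a (k : R[i]) : bounded_operator a ->
  opnorm (k *: a) <= Normc.normc k * opnorm a.
Proof.
move=> ba; apply: ge_sup.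
  by exists (l2norm ((k *: a) 0)); exists 0 => //=; rewrite l2norm0.
move=> _ [xi /= xi1 <-]; rewrite (l2norm_scale k (a xi)).
by rewrite ler_wpM2l ?normc_ge0// opnorm_ub.
Qed.

Lemma lambda_linear t : linear (@lambda R G t).
Proof. by move=> k xi eta; apply: val_inj. Qed.

Lemma lambda_comp s t : @lambda R G s \o lambda t = lambda (s * t)%g.
Proof.
by apply/funext => xi; apply/val_inj/funext => x /=; rewrite invgM mulgA.
Qed.

Lemma lambda_algE f xi :
  lambda_alg f xi = \sum_(t <- finsupp f) f t *: lambda t xi.
Proof. by rewrite /lambda_alg fct_sumE. Qed.

Lemma lambda_alg_linear f : linear (lambda_alg f).
Proof.
move=> k xi eta; rewrite !lambda_algE scaler_sumr -big_split /=.
apply: eq_bigr => t _; rewrite lambda_linear scalerDr; congr (_ + _).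
by rewrite !scalerA mulrC.
Qed.

(** Each new term costs a factor 2 through [l2norm_sqr_scaleD]. *)
Lemma l2norm_sum_lambda (r : seq G) (c : G -> R[i]) xi :
  l2norm (\sum_(t <- r) c t *: lambda t xi) ^+ 2 <=
  2 ^+ size r * (\sum_(t <- r) Normc.normc (c t) ^+ 2) * l2norm xi ^+ 2.
Proof.
elim: r => [|t r IH]; first by rewrite !big_nil l2norm0 expr0n mulr0 mul0r.
rewrite 2!big_cons; apply: le_trans (l2norm_sqr_scaleD _ _ _) _.
apply: le_trans (lerD (lexx _) (ler_wpM2l (ler0n _ 2) IH)) _.
rewrite l2norm_lambda [size (t :: r)]/= (exprS 2 (size r)).
set A := Normc.normc (c t) ^+ 2; set X := l2norm xi ^+ 2.
set B := \sum_(j <- r) Normc.normc (c j) ^+ 2; set p := 2 ^+ size r.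
have p1 : 1 <= p by rewrite exprn_ege1// ler1n.
have AX : A * X <= p * (A * X) by rewrite ler_peMl// mulr_ge0// sqr_ge0.
rewrite -subr_ge0 (_ : _ - _ = 2 * (p * (A * X) - A * X)); last by ring.
by rewrite mulr_ge0// subr_ge0.
Qed.

Lemma l2norm_finsupp f :
  l2norm f ^+ 2 = \sum_(t <- finsupp f) Normc.normc (f t) ^+ 2.
Proof.
rewrite /l2norm /sqnorm (@esum_finite_support _ _ (finsupp f)) /=.
- by rewrite sqr_sqrtr// sumr_ge0// => t _; exact: sqr_ge0.
- by move=> t; exact: sqr_ge0.
- move=> t; rewrite mem_finsupp; apply: contraNneq => ->.
  by rewrite Normc.normc0 expr0n.
Qed.

Lemma l2norm_fsfun_real (X : {fset G}) (c : G -> R) :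
  l2norm ([fsfun y in X => (c y)%:C] : {fsfun G -> R[i] with 0}) =
  Num.sqrt (\sum_(y <- X) c y ^+ 2).
Proof.
rewrite /l2norm /sqnorm (@esum_finite_support _ _ X) /=.
- congr Num.sqrt; apply: eq_fbigr => y yX _.
  rewrite fsfunE yX /Normc.normc /= expr0n addr0 sqr_sqrtr//.
  exact: sqr_ge0.
- by move=> y; exact: sqr_ge0.
- move=> y; rewrite fsfunE; case: ifP => //.
  by rewrite Normc.normc0 expr0n eqxx.
Qed.

Lemma l2norm_lambda_alg f (n : nat) xi : (size (finsupp f) <= n)%N ->
  l2norm (lambda_alg f xi) <= Num.sqrt (2 ^+ n) * l2norm f * l2norm xi.
Proof.
move=> fn; rewrite -(@ler_pXn2r _ 2)// ?nnegrE ?mulr_ge0 ?sqrtr_ge0//.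
rewrite lambda_algE; apply: le_trans (l2norm_sum_lambda _ _ _) _.
have n0 : 0 <= 2 ^+ n :> R by rewrite exprn_ge0.
rewrite !exprMn (sqr_sqrtr n0) -(l2norm_finsupp f).
by rewrite ler_wpM2r ?sqr_ge0// ler_wpM2r ?sqr_ge0// ler_weXn2l// ler1n.
Qed.

Lemma lambda_alg_bounded f : bounded_operator (lambda_alg f).
Proof.
split; first exact: lambda_alg_linear.
by eexists => xi; exact: l2norm_lambda_alg (leqnn _).
Qed.

Lemma reduced_cstar_lambda_alg f : reduced_cstar (lambda_alg f).
Proof.
split=> [|e e0]; first exact: lambda_alg_bounded.
exists f; rewrite subrr; apply: le_lt_trans e0; apply: opnorm_le => // xi.
by rewrite [leLHS](l2norm0 R G) mul0r.
Qed.

Lemma lambda_alg_fsfun (X : {fset G}) (c : G -> R[i]) :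
  lambda_alg [fsfun t in X => c t] = \sum_(t <- X) c t *: lambda t.
Proof.
pose F : {fsfun G -> R[i] with 0} := [fsfun t in X => c t].
have sub : (finsupp F `<=` X)%fset.
  by apply/fsubsetP => t; rewrite mem_finsupp fsfunE; case: ifP; rewrite ?eqxx.
rewrite -/F /lambda_alg (big_fset_incl _ sub) => [|t tX]; last first.
  by rewrite memNfinsupp => /eqP ->; rewrite scale0r.
by apply: eq_fbigr => t tX; rewrite fsfunE tX.
Qed.

Lemma rho_ge0 (S : {fset G}) n : 0 <= rho R S n.
Proof.
rewrite /rho; set A := (X in sup X).
have A0 y : A y -> 0 <= y.
  move=> [f _ <-]; rewrite divr_ge0 ?l2norm_ge0//.
  exact/opnorm_ge0/lambda_alg_bounded.
have [Asup|nsup] := pselect (has_sup A); last by rewrite sup_out.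
have [[y Ay] Aub] := Asup.
by apply: le_trans (A0 y Ay) _; exact: sup_ubound.
Qed.

(** Beyond the definition of rho as a supremum, this needs the quotients
    ||lambda(h)|| / ||h||_2 to be bounded for h supported in the ball;
    [l2norm_lambda_alg] bounds them in terms of the size of the ball. *)
Lemma opnorm_le_rho (S : {fset G}) (n : nat) f : finite_set (word_ball S n) ->
  [set` finsupp f] `<=` word_ball S n ->
  opnorm (lambda_alg f) <= rho R S n * l2norm f.
Proof.
move=> finB; have bound (h : {fsfun G -> R[i] with 0}) :
    [set` finsupp h] `<=` word_ball S n ->
    opnorm (lambda_alg h) <=
    Num.sqrt (2 ^+ size (fset_set (word_ball S n))) * l2norm h.
  move=> hB; apply: opnorm_le => [|xi].
    by rewrite mulr_ge0// ?sqrtr_ge0// l2norm_ge0.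
  apply: l2norm_lambda_alg; apply: uniq_leq_size; first exact: fset_uniq.
  by move=> t /hB tB; rewrite in_fset_set// inE.
move=> fB; have [f0|f0] := eqVneq (l2norm f) 0.
  by apply: le_trans (bound f fB) _; rewrite f0 !mulr0.
have fpos : 0 < l2norm f by rewrite lt_neqAle eq_sym f0 l2norm_ge0.
rewrite -ler_pdivrMr//; apply: sup_ubound; last first.
  exists f => //=; split=> // fE; move/eqP: f0; apply.
  apply/eqP; rewrite -sqrf_eq0 l2norm_finsupp fE big1// => t _.
  by rewrite fsfunE Normc.normc0 expr0n.
exists (Num.sqrt (2 ^+ size (fset_set (word_ball S n)))) => _ [h [_ hB] <-].
have [->|h0] := eqVneq (l2norm h) 0; first by rewrite invr0 mulr0 sqrtr_ge0.
by rewrite ler_pdivrMr ?bound// lt_neqAle eq_sym h0 l2norm_ge0.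
Qed.

Lemma reduced_cstar_scale (k : R[i]) f : reduced_cstar (k *: lambda_alg f).
Proof.
rewrite (_ : k *: _ = lambda_alg [fsfun t in finsupp f => k * f t]).
  exact: reduced_cstar_lambda_alg.
rewrite lambda_alg_fsfun /lambda_alg scaler_sumr.
by apply: eq_bigr => t _; rewrite scalerA.
Qed.

(** Since the functional norm of tau is 1 and not the default value 0 of [sup],
    the set that defines it is bounded, so |tau b| <= 1 on the unit ball. With
    a = lambda(f), this is applied to b = (||a|| + e)^-1 a, where e > 0 allows
    for ||a|| = 0. *)
Lemma state_le_opnorm_alg (tau : (H -> H) -> R[i]) f : is_state tau ->
  Normc.normc (tau (lambda_alg f)) <= opnorm (lambda_alg f).
Proof.
move=> [tau_lin _ tau1]; set a := lambda_alg f.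
have tauZ k : tau (k *: a) = k * tau a.
  have ra := reduced_cstar_lambda_alg f.
  have r0 := reduced_cstar_scale 0 f; rewrite scale0r in r0.
  have tau0 : tau 0 = 0.
    apply: (addrI (tau 0)); rewrite addr0 -{1}(mul1r (tau 0)) -tau_lin//.
    by rewrite scale1r addr0.
  by rewrite -[k *: a]addr0 tau_lin// tau0 addr0.
have ub b : reduced_cstar b -> opnorm b <= 1 -> Normc.normc (tau b) <= 1.
  move=> rb b1; rewrite -tau1; apply: sup_ubound; last by exists b.
  have [] : has_sup [set Normc.normc (tau c) |
      c in [set c | reduced_cstar c /\ opnorm c <= 1]] => //.
  apply: contrapT => nosup; move: tau1; rewrite /functional_norm sup_out//.
  by move/eqP; rewrite eq_sym oner_eq0.
apply/ler_addgt0Pr => e e0; have ba := lambda_alg_bounded f.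
have c0 : 0 < opnorm a + e by rewrite ltr_wpDl// opnorm_ge0.
have nc : Normc.normc ((opnorm a + e)^-1)%:C = (opnorm a + e)^-1.
  by rewrite /Normc.normc /= expr0n addr0 sqrtr_sqr gtr0_norm// invr_gt0.
have := ub (((opnorm a + e)^-1)%:C *: a) (reduced_cstar_scale _ _).
rewrite tauZ Normc.normcM nc ler_pdivrMl// mulr1; apply.
apply: le_trans (opnorm_scale _ ba) _.
by rewrite nc ler_pdivrMl// mulr1 lerDl ltW.
Qed.

End operator_norm.

(** * Return probabilities *)

Section return_probability.
Variables (R : realType) (G : groupType) (mu : G -> R) (T : {fset G}).
Hypothesis mu_ge0 : forall t, 0 <= mu t.
Hypothesis mu_supp : forall t, mu t != 0 -> t \in T.

Lemma conj_kernel_ge0 n x y : 0 <= conj_kernel T mu n x y.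
Proof.
elim: n x => [|n IH] x; first exact: ler0n.
by rewrite conj_kernelS sumr_ge0// => t _; rewrite mulr_ge0.
Qed.

Lemma conj_kernel_le1 n x y : \sum_(t <- T) mu t = 1 ->
  conj_kernel T mu n x y <= 1.
Proof.
move=> mu1; elim: n x => [|n IH] x.
  by rewrite /conj_kernel /=; case: (_ == _); rewrite ?lexx ?ler01.
rewrite conj_kernelS -mu1; apply: ler_sum => t _.
by rewrite -[leRHS]mulr1 ler_wpM2l.
Qed.

Hypothesis mu_inv : symmetric_measure mu.
Hypothesis T_inv : forall t, t \in T -> (t^-1)%g \in T.

(** The coset x C(g) is the set of all z with z g z^-1 = y, where y = x g x^-1.
    For y outside the conjugacy class of g this set is empty and both sides are
    0, which lets the induction run over all y. *)
Lemma walk_prob_conj_kernel g n y :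
  walk_prob mu (centralizer g) n [set z | (z * g * z^-1)%g = y] =
  (conj_kernel T mu n y g)%:E.
Proof.
elim: n y => [|n IH] y.
  rewrite /conj_kernel /=; case: (eqVneq y g) => [->|yg]; last first.
    rewrite asboolF// => yC; move/eqP: yg; apply.
    have : centralizer g 1%g by rewrite /centralizer /commute /= mul1g mulg1.
    by rewrite -yC /= mul1g invg1 mulg1.
  rewrite asboolT//; apply/seteqP; split=> z /= zg.
    by rewrite /centralizer /commute /= -{2}zg mulgVK.
  by rewrite zg mulgK.
(* The coset of y comes from that of t^-1 y t, so t is replaced by t^-1 in the
   recursion of the kernel. *)
rewrite conj_kernelS -(sum_inv T_inv) -(@esum_finite_support _ _ T).
- apply: eq_esum => t _; rewrite -mu_inv invgK EFinM -IH.
  congr (_ * walk_prob _ _ _ _)%E; apply/seteqP.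
  have conjM z : (t * z * g * (t * z)^-1 = t * (z * g * z^-1) * t^-1)%g.
    by rewrite invgM !mulgA.
  rewrite /translate_inv; split=> z /=; rewrite conjM => zy.
    by rewrite -zy !mulgA mulVg mul1g mulgVK.
  by rewrite zy !mulgA mulgV mul1g mulgK.
- by move=> t; rewrite mulr_ge0// conj_kernel_ge0.
- by move=> t; rewrite mulf_eq0 negb_or -mu_inv => /andP[/mu_supp].
Qed.

Lemma return_prob_conj_kernel g n :
  return_prob mu g n = conj_kernel T mu n g g.
Proof.
have CE : centralizer g = [set z | (z * g * z^-1)%g = g].
  apply/seteqP; split=> z /= zg; first by rewrite zg mulgK.
  by rewrite /centralizer /commute /= -{2}zg mulgVK.
by rewrite /return_prob {2}CE walk_prob_conj_kernel.
Qed.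

End return_probability.

(** * Stationary states *)

Section stationary_state.
Variables (R : realType) (G : groupType).
Local Notation H := (ell2 R G).
Variable tau : (H -> H) -> R[i].
Hypothesis tau_state : is_state tau.

Lemma reduced_cstar_lambda t : reduced_cstar (@lambda R G t).
Proof.
rewrite (_ : lambda t = lambda_alg [fsfun s in [fset t]%fset => 1]).
  exact: reduced_cstar_lambda_alg.
by rewrite lambda_alg_fsfun big_seq_fset1 scale1r.
Qed.

Lemma state_sum_lambda (X : {fset G}) (c : G -> R[i]) :
  tau (\sum_(t <- X) c t *: lambda t) = \sum_(t <- X) c t * tau (lambda t).
Proof.
have [tau_lin _ _] := tau_state.
have rsum (Y : {fset G}) : reduced_cstar (\sum_(t <- Y) c t *: @lambda R G t).
  by rewrite -lambda_alg_fsfun; exact: reduced_cstar_lambda_alg.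
elim/fset1U_rect: X => [|x X xX IH].
  have r0 := rsum fset0; rewrite !big_seq_fset0 in r0 *.
  apply: (addrI (tau 0)); rewrite addr0 -{1}(mul1r (tau 0)) -tau_lin//.
  by rewrite scale1r addr0.
rewrite !big_fsetU1//= tau_lin ?IH//; exact: reduced_cstar_lambda.
Qed.

Variables (mu : G -> R) (T : {fset G}).
Hypothesis mu_supp : forall t, mu t != 0 -> t \in T.
Hypothesis tau_stationary : stationary mu tau.

(** Stationarity applied to lambda_x, whose conjugate by lambda_t is
    lambda_(t x t^-1). *)
Lemma stationary_harmonic n x :
  iter n (conj_avg T (fun t => (mu t)%:C)) (fun y => tau (lambda y)) x =
  tau (lambda x).
Proof.
elim: n x => [//|n IH] x; rewrite iterS /conj_avg; under eq_bigr do rewrite IH.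
rewrite [RHS](tau_stationary (reduced_cstar_lambda x)).
rewrite (@complex_sum_finite_support _ _ T) => [|t].
  by apply: eq_bigr => t _; rewrite !lambda_comp.
rewrite mulf_eq0 negb_or => /andP[mut _]; apply: mu_supp.
by apply: contraNneq mut => ->.
Qed.

End stationary_state.

(** * The vanishing of stationary states *)

Lemma sqrt_le_powR_quarter (R : realType) (p : R) : 0 <= p <= 1 ->
  Num.sqrt p <= p `^ (4%:R^-1).
Proof.
move=> /andP[p0 p1]; rewrite -powR12_sqrt//.
have [->|pN0] := eqVneq p 0.
  by rewrite !powR0// ?invr_eq0 ?pnatr_eq0.
apply: ger_powR; first by rewrite lt_neqAle eq_sym pN0 p0.
by rewrite lef_pV2 ?posrE ?ltr0n// ler_nat.
Qed.

(** The set T is the support of mu, which is finite because balls are; it serves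
    as the index set of all averages over mu. *)
Lemma symmetric_prob_support (R : realType) (G : groupType) (S : {fset G})
    (mu : G -> R) (N : nat) :
  generates S -> is_prob mu -> symmetric_measure mu ->
  (forall t, mu t != 0 -> word_ball S N t) ->
  exists T : {fset G}, [/\ forall t, (t \in T) = (mu t != 0),
    forall t, t \in T -> (t^-1)%g \in T & \sum_(t <- T) mu t = 1].
Proof.
move=> S_generates [mu_ge0 mu_sum] mu_symmetric mu_supp.
have finT : finite_set [set t | mu t != 0].
  exact: sub_finite_set mu_supp (finite_word_ball S_generates N).
have memT t : (t \in fset_set [set t | mu t != 0]) = (mu t != 0).
  by rewrite in_fset_set//; apply/idP/idP; rewrite inE.
exists (fset_set [set t | mu t != 0]); split=> // [t|].
  by rewrite !memT -mu_symmetric.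
have mu_T t : mu t != 0 -> t \in fset_set [set t | mu t != 0] by rewrite memT.
by apply: EFin_inj; rewrite -mu_sum (esum_finite_support mu_ge0 mu_T).
Qed.

Lemma stationary_state_bound (R : realType) (G : groupType) (S : {fset G})
    (mu : G -> R) (N n : nat) (g : G) (tau : (ell2 R G -> ell2 R G) -> R[i]) :
  generates S -> is_prob mu -> symmetric_measure mu ->
  (forall t, mu t != 0 -> word_ball S N t) ->
  is_state tau -> stationary mu tau ->
  Normc.normc (tau (lambda g)) <=
  rho R S (2 * n * N + word_length S g)%N * Num.sqrt (return_prob mu g (2 * n)).
Proof.
move=> S_generates mu_prob mu_symmetric mu_supp tau_state tau_stat.
have [T [memT T_inv _]] :=
  symmetric_prob_support S_generates mu_prob mu_symmetric mu_supp.
have [mu_ge0 _] := mu_prob; have finB := finite_word_ball S_generates.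
have mu_T t : mu t != 0 -> t \in T by rewrite memT.
have mu_inv t : mu (t^-1)%g = mu t by rewrite -mu_symmetric.
set r := (2 * n * N + _)%N; pose X := fset_set (word_ball S r).
(* A walk with m steps left must keep 2 m N in reserve, as each conjugation by
   an element of T adds at most 2 N to the length. *)
pose B x m := (word_length S x + 2 * m * N <= r)%N.
have B_conj t y m : t \in T -> B y m.+1 -> B (t * y * t^-1)%g m.
  move=> tT; apply: leq_trans.
  have tN : (word_length S t <= N)%N by apply: mu_supp; rewrite -memT.
  have tVN : (word_length S (t^-1)%g <= N)%N.
    by apply: mu_supp; rewrite -memT T_inv.
  rewrite mulnS mulnDl addnA leq_add2r mul2n -addnn addnA.
  rewrite (addnC (word_length S y)).
  apply: leq_trans (word_lengthM S_generates _ _) _; apply: leq_add _ tVN.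
  exact: leq_trans (word_lengthM S_generates _ _) (leq_add tN (leqnn _)).
have B_X y : B y 0%N -> y \in X.
  by rewrite /B muln0 mul0n addn0 in_fset_set// inE.
have B_g : B g n by rewrite /B addnC.
pose F : {fsfun G -> R[i] with 0} :=
  [fsfun y in X => (conj_kernel T mu n g y)%:C].
have tauF : tau (lambda g) = tau (lambda_alg F).
  rewrite lambda_alg_fsfun state_sum_lambda//.
  rewrite -(stationary_harmonic mu_T tau_stat n).
  rewrite (conj_kernel_expansion _ _ B_conj B_X B_g).
  by apply: eq_bigr => y _; rewrite (conj_kernel_rmorph (real_complex R)) mulrC.
have F_supp : [set` finsupp F] `<=` word_ball S r.
  move=> y /=; rewrite mem_finsupp fsfunE.
  by case: ifP => [|_]; [rewrite in_fset_set// inE|rewrite eqxx].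
rewrite tauF; apply: le_trans (state_le_opnorm_alg F tau_state) _.
apply: le_trans (opnorm_le_rho (finB _) F_supp) _.
rewrite l2norm_fsfun_real (conj_kernel_sqr_sum T_inv mu_inv B_conj B_X B_g).
by rewrite (return_prob_conj_kernel mu_ge0 mu_T).
Qed.

Theorem theorem2 (R : realType) (G : groupType) (S : {fset G})
  (S_symmetric : symmetric_set S) (S_generates : generates S)
  (mu : G -> R) (mu_prob : is_prob mu) (mu_symmetric : symmetric_measure mu)
  (N : nat) (mu_supp : forall t, mu t != 0 -> word_ball S N t)
  (g : G)
  (liminf0 : limn_einf (fun n : nat =>
      (rho R S (2 * n * N + word_length S g)%N
       * return_prob mu g (2 * n)%N `^ (4%:R^-1))%:E) = 0%:E)
  (tau : (ell2 R G -> ell2 R G) -> R[i])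
  (tau_state : is_state tau) (tau_stationary : stationary mu tau) :
  tau (lambda g) = 0.
Proof.
apply: Normc.eq0_normc; apply/eqP; rewrite eq_le normc_ge0 andbT.
rewrite -lee_fin -liminf0; apply: limn_einf_ge => n; rewrite lee_fin.
apply: le_trans (stationary_state_bound n g S_generates mu_prob mu_symmetric
  mu_supp tau_state tau_stationary) _.
have [T [memT T_inv mu1]] :=
  symmetric_prob_support S_generates mu_prob mu_symmetric mu_supp.
have [mu_ge0 _] := mu_prob; have mu_T t : mu t != 0 -> t \in T by rewrite memT.
rewrite ler_wpM2l ?rho_ge0// sqrt_le_powR_quarter//.
rewrite (return_prob_conj_kernel mu_ge0 mu_T)//.
by rewrite conj_kernel_ge0// conj_kernel_le1.
Qed.
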